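(* If a non-zero function $f\in\mathcal F_1$ satisfies an equation $\varphi(f)=0$ with $0\neq\varphi\in\mathfrak A_1$, then $f$ is quasi-holonomic, i.e. $d(M_f)=1$.
   Context: Let $q$ be a power of a prime $p$, $K=\mathbb F_q((x))$ the field of formal Laurent series with its absolute value $|x|=q^{-1}$, and $\overline{K}_c$ the completion of an algebraic closure of $K$ with the extended absolute value. $\mathcal F_1$ is the set of germs at the origin of $\mathbb F_q$-linear power series $f(s)=\sum_{m\ge0}a_ms^{q^m}$, $a_m\in\overline{K}_c$, converging on some neighbourhood of the origin. The Carlitz ring $\mathfrak A_1$ is the ring of operators on $\mathcal F_1$ generated by $\tau f=f^q$, by the Carlitz derivative $d_sf(s)=\bigl(f(xs)-xf(s)\bigr)^{1/q}$, and by multiplications by scalars from $\overline{K}_c$. Every element of $\mathfrak A_1$ is a finite sum $\sum c_{l,\mu}\tau^ld_s^\mu$ with $c_{l,\mu}\in\overline{K}_c$. For $0\ne f\in\mathcal F_1$ let $I_f=\{\varphi\in\mathfrak A_1:\varphi(f)=0\}$ (a left ideal) and $M_f=\mathfrak A_1/I_f\cong\mathfrak A_1f$. Let $\mathfrak M_j$ be the $\overline{K}_c$-span of the elements $\tau^ld_s^\mu f$ with $l+\mu\le j$. There is a polynomial $\chi\in\mathbb Q[t]$ with $\dim_{\overline{K}_c}\mathfrak M_j=\chi(j)$ for all large $j$, and $d(M_f)=\deg\chi$ is the (Gelfand–Kirillov) dimension. The function $f\in\mathcal F_1$ is called quasi-holonomic if $d(M_f)=1$. *)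

(* Defs.v *)
From HB Require Import structures.
From mathcomp Require Import all_boot all_order all_algebra all_field.
From mathcomp Require Import all_classical reals.
From mathcomp Require Import zify ring lra.

Set Implicit Arguments.
Unset Strict Implicit.
Unset Printing Implicit Defensive.

Import Order.TTheory GRing.Theory Num.Theory.
Local Open Scope classical_set_scope.
Local Open Scope ring_scope.

Section LaurentSeries.
Variable F : fieldType.
Implicit Types (f g h : int -> F) (a b c : nat -> F) (N M : int).

Definition vanish_below N f := forall n, n < N -> f n = 0.

Definition bounded_below : {pred int -> F} :=
  fun f => `[< exists N, vanish_below N f >].

(* Formal Laurent series over F, as their coefficient sequences. *)
Record laurent := Laurent { lcoef :> int -> F; _ : lcoef \in bounded_below }.

HB.instance Definition _ := [isSub for lcoef].
HB.instance Definition _ := [Choice of laurent by <:].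

Lemma vanish_belowW N M f : N <= M -> vanish_below M f -> vanish_below N f.
Proof. by move=> NM fM n nN; apply: fM; exact: lt_le_trans NM. Qed.

Fact bounded_below_zmod : zmod_closed bounded_below.
Proof.
split=> [|f g]; first by apply/asboolP; exists 0.
move=> /asboolP[N fN] /asboolP[M gM]; apply/asboolP; exists (Num.min N M) => n.
by rewrite lt_min => /andP[nN nM]; rewrite !fctE fN// gM// subr0.
Qed.
HB.instance Definition _ :=
  GRing.isZmodClosed.Build _ bounded_below bounded_below_zmod.
HB.instance Definition _ := [SubChoice_isSubZmodule of laurent by <:].

(* The sum has only finitely many nonzero terms when f and g vanish at all
   sufficiently negative indices. *)
Definition cauchy_prod f g : int -> F :=
  fun n => \sum_(i \in [set: int]) f i * g (n - i).

Definition nat_prod a b : nat -> F :=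
  fun k => \sum_(i < k.+1) a i * b (k - i)%N.

Definition tail N f : nat -> F := fun k => f (N + k%:Z).

Lemma cauchy_prod_window f g n (s : seq int) : uniq s ->
    (forall i, i \notin s -> f i * g (n - i) = 0) ->
  cauchy_prod f g n = \sum_(i <- s) f i * g (n - i).
Proof.
move=> us h; rewrite fsbig_seq//; apply/esym/fsbig_widen => // i /= [_].
by move/negP => /h.
Qed.

Lemma cauchy_prod_lt f g N M : vanish_below N f -> vanish_below M g ->
  vanish_below (N + M) (cauchy_prod f g).
Proof.
move=> fN gM n nNM; rewrite (@cauchy_prod_window _ _ _ [::]) ?big_nil// => i _.
have [/fN ->|Ni] := ltP i N; first by rewrite mul0r.
by rewrite gM ?mulr0//; lia.
Qed.

Lemma tail_cauchy_prod f g N M : vanish_below N f -> vanish_below M g ->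
  tail (N + M) (cauchy_prod f g) =1 nat_prod (tail N f) (tail M g).
Proof.
move=> fN gM k; rewrite /tail.
rewrite (@cauchy_prod_window _ _ _ [seq N + i%:Z | i <- iota 0 k.+1]).
- rewrite big_map -[iota 0 k.+1]/(index_iota 0 k.+1) big_mkord; apply: eq_bigr => i _.
  by congr (_ * g _); have := ltn_ord i; lia.
- by rewrite map_inj_uniq ?iota_uniq// => i j; lia.
- move=> i ni; have [/fN ->|Ni] := ltP i N; first by rewrite mul0r.
  rewrite gM ?mulr0//; rewrite ltNge; apply/negP => Mi.
  move/negP: ni; apply; apply/mapP; exists `|i - N|%N; last by lia.
  by rewrite mem_iota; lia.
Qed.

(* The ring laws are transported from polynomials by truncation. *)
Definition trunc n a : {poly F} := \poly_(i < n.+1) a i.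

Lemma coef_trunc n a i : (i <= n)%N -> (trunc n a)`_i = a i.
Proof. by move=> le; rewrite coef_poly ltnS le. Qed.

Lemma nat_prodE n a b i : (i <= n)%N -> nat_prod a b i = (trunc n a * trunc n b)`_i.
Proof.
move=> le; rewrite coefM; apply: eq_bigr => j _.
by rewrite !coef_trunc//; have := ltn_ord j; lia.
Qed.

Lemma eq_nat_prod a a' b b' : a =1 a' -> b =1 b' -> nat_prod a b =1 nat_prod a' b'.
Proof. by move=> ha hb k; apply: eq_bigr => i _; rewrite ha hb. Qed.

Lemma nat_prodC a b : nat_prod a b =1 nat_prod b a.
Proof. by move=> n; rewrite !(@nat_prodE n)// mulrC. Qed.

Lemma nat_prodA a b c : nat_prod a (nat_prod b c) =1 nat_prod (nat_prod a b) c.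
Proof.
move=> n; have E d e i : (i <= n)%N -> (trunc n (nat_prod d e))`_i = (trunc n d * trunc n e)`_i.
  by move=> le; rewrite coef_trunc// (@nat_prodE n).
transitivity ((trunc n a * (trunc n b * trunc n c))`_n).
  rewrite (@nat_prodE n)// !coefM; apply: eq_bigr => i _.
  by rewrite E//; have := ltn_ord i; lia.
rewrite mulrA (@nat_prodE n)// !coefM; apply: eq_bigr => i _.
by rewrite E//; have := ltn_ord i; lia.
Qed.

Definition nat_one : nat -> F := fun k => (k == 0)%:R.

Lemma nat_prod1 a : nat_prod nat_one a =1 a.
Proof.
move=> k; rewrite /nat_prod big_ord_recl /= mul1r subn0 big1 ?addr0// => i _.
by rewrite mul0r.
Qed.

Lemma nat_prodDl a b c :
  nat_prod (fun k => a k + b k) c =1 (fun k => nat_prod a c k + nat_prod b c k).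
Proof. by move=> k; rewrite -big_split; apply: eq_bigr => i _; rewrite mulrDl. Qed.

Fixpoint inv_prefix a n : seq F :=
  if n is m.+1 then
    let s := inv_prefix a m in
    rcons s (- (a 0)^-1 * \sum_(i < n) a i.+1 * s`_(m - i))
  else [:: (a 0)^-1].

Definition nat_inv a : nat -> F := fun n => (inv_prefix a n)`_n.

Lemma size_inv_prefix a n : size (inv_prefix a n) = n.+1.
Proof. by elim: n => //= n IH; rewrite size_rcons IH. Qed.

Lemma inv_prefixE a n i : (i <= n)%N -> (inv_prefix a n)`_i = nat_inv a i.
Proof.
elim: n => [|n IH] in i *; first by rewrite leqn0 => /eqP ->.
rewrite leq_eqVlt => /orP[/eqP ->//|le].
by rewrite /= nth_rcons size_inv_prefix le IH.
Qed.

Lemma nat_prodV a : a 0 != 0 -> nat_prod a (nat_inv a) =1 nat_one.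
Proof.
move=> a0 [|k]; rewrite /nat_prod big_ord_recl/=.
  by rewrite big_ord0 addr0 /nat_inv/= divff.
rewrite subn0 {1}/nat_inv/= nth_rcons size_inv_prefix ltnn eqxx mulNr mulrN mulrA.
rewrite divff// mul1r addrC; apply/eqP; rewrite subr_eq0; apply/eqP/eq_bigr => i _.
by rewrite /bump /= add1n subSS inv_prefixE// leq_subr.
Qed.

Lemma laurent_bound (u : laurent) : exists N, vanish_below N u.
Proof. by case: u => u /= /asboolP. Qed.

Lemma bound2 (u v : laurent) : exists N, vanish_below N u /\ vanish_below N v.
Proof.
have [N uN] := laurent_bound u; have [M vM] := laurent_bound v.
exists (Num.min N M); split; [apply: vanish_belowW uN|apply: vanish_belowW vM];
  by rewrite ge_min lexx ?orbT.
Qed.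

Lemma bounded_belowP f : (exists N, vanish_below N f) -> f \in bounded_below.
Proof. by move=> h; apply/asboolP. Qed.

Lemma laurent_eq N (u v : laurent) : vanish_below N u -> vanish_below N v ->
  tail N u =1 tail N v -> u = v.
Proof.
move=> uN vN uv; apply/val_inj/funext => n /=.
have [nN|Nn] := ltP n N; first by rewrite uN// vN.
by have := uv `|n - N|%N; rewrite /tail; have -> : N + `|n - N|%N = n by lia.
Qed.

Definition laurent_cst (d : F) : int -> F := fun n => if n == 0 then d else 0.

Fact laurent_cst_subproof d : laurent_cst d \in bounded_below.
Proof.
apply: bounded_belowP; exists 0 => n n0; rewrite /laurent_cst.
by case: eqP n0 => // ->.
Qed.
Definition laurentC d : laurent := Laurent (laurent_cst_subproof d).

Fact laurent_mul_subproof (u v : laurent) : cauchy_prod u v \in bounded_below.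
Proof.
have [N [uN vN]] := bound2 u v; apply: bounded_belowP; exists (N + N).
exact: cauchy_prod_lt.
Qed.
Definition laurent_mul u v : laurent := Laurent (laurent_mul_subproof u v).

Fact laurent_mulC : commutative laurent_mul.
Proof.
move=> u v; have [N [uN vN]] := bound2 u v.
apply: (@laurent_eq (N + N)); try exact: cauchy_prod_lt.
by move=> k; rewrite !tail_cauchy_prod// nat_prodC.
Qed.

Fact laurent_mulA : associative laurent_mul.
Proof.
move=> u v w; have [N [uN vN]] := bound2 u v; have [M wM] := laurent_bound w.
have uv := cauchy_prod_lt uN vN; have vw := cauchy_prod_lt vN wM.
apply: (@laurent_eq (N + N + M)); first by rewrite -addrA; exact: cauchy_prod_lt.
  exact: cauchy_prod_lt.
move=> k; rewrite -{1}addrA !tail_cauchy_prod//.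
rewrite (eq_nat_prod (frefl _) (tail_cauchy_prod vN wM)) nat_prodA.
by apply: eq_nat_prod => // i; rewrite tail_cauchy_prod.
Qed.

Fact laurent_mul1 : left_id (laurentC 1) laurent_mul.
Proof.
move=> u; have [N uN] := laurent_bound u.
have b1 : vanish_below 0 (laurentC 1).
  by move=> n n0; rewrite /= /laurent_cst; case: eqP n0 => // ->.
apply: (@laurent_eq N) => //; first by rewrite -[N]add0r; exact: cauchy_prod_lt.
move=> k; rewrite -{1}[N]add0r tail_cauchy_prod//.
rewrite -[RHS]nat_prod1; apply: eq_nat_prod => // i.
by rewrite /tail add0r /= /laurent_cst /nat_one; case: i.
Qed.

Fact laurent_mulDl : left_distributive laurent_mul +%R.
Proof.
move=> u v w; have [N [uN vN]] := bound2 u v; have [M wM] := laurent_bound w.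
have uvN : vanish_below N (u + v) by move=> n nN /=; rewrite !fctE uN// vN// addr0.
apply: (@laurent_eq (N + M)); first exact: cauchy_prod_lt.
  by move=> n nN /=; rewrite !fctE (cauchy_prod_lt uN wM)// (cauchy_prod_lt vN wM)// addr0.
move=> k; rewrite tail_cauchy_prod//.
rewrite -[RHS]/(tail (N + M) (cauchy_prod u w) k + tail (N + M) (cauchy_prod v w) k).
rewrite !tail_cauchy_prod// -nat_prodDl; exact: eq_nat_prod.
Qed.

Fact laurent_1neq0 : laurentC 1 != 0.
Proof.
apply/eqP => /(congr1 (fun u : laurent => u 0)); rewrite /= /laurent_cst eqxx.
by move/eqP; rewrite oner_eq0.
Qed.

HB.instance Definition _ := GRing.Zmodule_isComNzRing.Build laurent
  laurent_mulA laurent_mulC laurent_mul1 laurent_mulDl laurent_1neq0.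

Definition is_ord (u : laurent) (n : int) := u n != 0 /\ vanish_below n u.

Lemma is_ord_exists u : u != 0 -> exists n, is_ord u n.
Proof.
move=> u0; have [N uN] := laurent_bound u.
have [k uk] : exists k, tail N u k != 0.
  apply: contrapT => h; move/eqP: u0; apply; apply: (@laurent_eq N) => // k.
  by apply: contrapT => uk; apply: h; exists k; exact/eqP.
have exk : exists k, tail N u k != 0 by exists k.
case: (ex_minnP exk) => m um mmin; exists (N + m%:Z); split => // n nm.
have [/uN//|Nn] := ltP n N; apply: contrapT => /eqP un.
have /mmin : tail N u `|n - N|%N != 0 by rewrite /tail; have -> : N + `|n - N|%N = n by lia.
lia.
Qed.

Definition laurent_inv (u : laurent) : laurent :=
  if u == 0 then 0 else xget 0 [set v | v * u = 1].

Fact laurent_mulV u : u != 0 -> laurent_inv u * u = 1.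
Proof.
move=> u0; rewrite /laurent_inv (negPf u0); apply: (xgetPex 0 (P := [set v | v * u = 1])).
have [N [uN0 uN]] := is_ord_exists u0.
pose f (n : int) : F := if n < - N then 0 else nat_inv (tail N u) `|(n + N)%R|%N.
have fN : vanish_below (- N) f by move=> n nN; rewrite /f nN.
have bf : f \in bounded_below by apply: bounded_belowP; exists (- N).
exists (Laurent bf); rewrite /= mulrC; apply: (@laurent_eq 0).
- by rewrite -(subrr N); exact: cauchy_prod_lt.
- by move=> n n0; rewrite /= /laurent_cst; case: eqP n0 => // ->.
move=> k; rewrite -{1}(subrr N) tail_cauchy_prod//.
rewrite (eq_nat_prod (frefl _) (_ : _ =1 nat_inv (tail N u))).
  by rewrite nat_prodV; [rewrite /tail/= /laurent_cst /nat_one; case: k|rewrite /tail addr0].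
by move=> i; rewrite /tail /f /=; case: ifP; [lia|have -> : `|(- N + i%:Z + N)%R|%N = i by lia].
Qed.

Fact laurent_inv0 : laurent_inv 0 = 0.
Proof. by rewrite /laurent_inv eqxx. Qed.

HB.instance Definition _ :=
  GRing.ComNzRing_isField.Build laurent laurent_mulV laurent_inv0.

End LaurentSeries.

Section LaurentAbsoluteValue.
Variables (R : realType) (F : finFieldType).

Definition laurent_ord (u : laurent F) : int := xget 0 [set n | is_ord u n].

(* |u| = q^(- ord u) with q = #|F|, so that the series x has |x| = 1/q. *)
Definition laurent_abs (u : laurent F) : R :=
  if u == 0 then 0 else #|F|%:R ^ (- laurent_ord u).

Fact laurentX_subproof : (fun n : int => (n == 1)%:R : F) \in @bounded_below F.
Proof.
apply: bounded_belowP; exists 0 => n n0.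
by case: eqP n0 => // ->.
Qed.
Definition laurentX : laurent F := Laurent laurentX_subproof.

Lemma laurent_abs_X : laurent_abs laurentX = #|F|%:R^-1.
Proof.
have o1 : is_ord laurentX 1.
  by split; [rewrite /= oner_neq0|move=> n n1 /=; case: eqP n1 => // ->].
rewrite /laurent_abs ifF; last first.
  by apply/eqP => h; case: o1; rewrite h eqxx.
have [] := xgetPex 0 (P := [set n | is_ord laurentX n]) (ex_intro _ _ o1).
rewrite -/(laurent_ord _) /=; case: (laurent_ord _ =P 1) => [-> _ _|_].
  by rewrite exprN1.
by rewrite eqxx.
Qed.

End LaurentAbsoluteValue.

Definition absolute_value (R : realType) (E : fieldType) (a : E -> R) : Prop :=
  [/\ forall z, 0 <= a z,
      forall z, a z = 0 <-> z = 0,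
      forall z w, a (z * w) = a z * a w &
      forall z w, a (z + w) <= Num.max (a z) (a w)].

Definition abs_cvg (R : realType) (E : fieldType) (a : E -> R)
    (u : nat -> E) (l : E) : Prop :=
  forall e : R, 0 < e -> exists N, forall n, (N <= n)%N -> a (u n - l) < e.

Definition abs_cauchy (R : realType) (E : fieldType) (a : E -> R)
    (u : nat -> E) : Prop :=
  forall e : R, 0 < e ->
    exists N, forall m n, (N <= m)%N -> (N <= n)%N -> a (u m - u n) < e.

(* A completion of an algebraic closure of F((x)): an algebraic closure ac_field
   carrying an absolute value that extends the one of F((x)), and a complete
   field cc_field containing it isometrically as a dense subfield.  These data
   determine cc_field up to isometric isomorphism. *)
Record completed_closure (R : realType) (F : finFieldType) := CompletedClosure {
  ac_field : closedFieldType;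
  ac_in : {rmorphism laurent F -> ac_field};
  ac_algebraic : forall z : ac_field, algebraicOver ac_in z;
  ac_abs : ac_field -> R;
  ac_absP : absolute_value ac_abs;
  ac_abs_extends : forall u, ac_abs (ac_in u) = laurent_abs R u;
  cc_field :> fieldType;
  cc_abs : cc_field -> R;
  cc_absP : absolute_value cc_abs;
  cc_complete : forall u, abs_cauchy cc_abs u -> exists l, abs_cvg cc_abs u l;
  cc_in : {rmorphism ac_field -> cc_field};
  cc_isometry : forall z, cc_abs (cc_in z) = ac_abs z;
  cc_dense : forall z (e : R), 0 < e -> exists w, cc_abs (z - cc_in w) < e
}.

Section CarlitzRing.
Variables (R : realType) (F : finFieldType) (C : completed_closure R F).

Local Notation q := #|F|.
Local Notation abs := (@cc_abs R F C).
Local Notation x := (cc_in C (ac_in C (laurentX F))).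
Implicit Types (f g : C -> C^o) (z w s : C).

Lemma q_gt1 : (1 < q)%N.
Proof. exact: finNzRing_gt1. Qed.

Lemma q_gt0 : (0 < q)%N.
Proof. exact: ltnW q_gt1. Qed.

Lemma abs_ge0 z : 0 <= abs z.
Proof. by case: (cc_absP C). Qed.

Lemma abs0P z : abs z = 0 <-> z = 0.
Proof. by case: (cc_absP C). Qed.

Lemma abs0 : abs 0 = 0.
Proof. exact/abs0P. Qed.

Lemma absM z w : abs (z * w) = abs z * abs w.
Proof. by case: (cc_absP C). Qed.

Lemma absD_max z w : abs (z + w) <= Num.max (abs z) (abs w).
Proof. by case: (cc_absP C). Qed.

Lemma abs1 : abs 1 = 1.
Proof.
have h : abs 1 != 0 by apply/eqP => /abs0P/eqP; rewrite oner_eq0.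
by apply: (mulfI h); rewrite -absM !mulr1.
Qed.

Lemma absX z n : abs (z ^+ n) = abs z ^+ n.
Proof. by elim: n => [|n IH]; rewrite ?expr0 ?abs1// !exprS absM IH. Qed.

Lemma absN z : abs (- z) = abs z.
Proof.
apply/eqP; rewrite -(@eqrXn2 _ 2)// ?abs_ge0//.
by rewrite -!absX sqrrN.
Qed.

Lemma absDlt z w (e : R) : abs z < e -> abs w < e -> abs (z + w) < e.
Proof.
by move=> ze we; apply: le_lt_trans (absD_max z w) _; rewrite gt_max ze we.
Qed.

Lemma abs_x : abs x = q%:R^-1.
Proof. by rewrite cc_isometry ac_abs_extends laurent_abs_X. Qed.

Lemma abs_x_mul s : abs (x * s) <= abs s.
Proof.
rewrite absM abs_x ler_piMl ?abs_ge0// invf_le1 ?ltr0n ?q_gt0//.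
by rewrite ler1n q_gt0.
Qed.

Lemma pchar_nat_q : [pchar C].-nat q.
Proof.
have [p pp pF] := finPcharP F.
have pg : p.-nat q.
  by have := pprimeChar_pgroup pF; rewrite /pgroup.pgroup cardsT.
suff pC : p \in [pchar C] by rewrite (eq_pnat _ (pcharf_eq pC)).
rewrite inE pp /=.
suff p0 : (p%:R : laurent F) = 0.
  by rewrite -(rmorph_nat (cc_in C)) -(rmorph_nat (ac_in C)) p0 !rmorph0.
apply/val_inj/funext => n; rewrite raddfMn /=.
rewrite -[LHS]/((laurent_cst 1 *+ p) n) /=.
have -> : (laurent_cst 1 *+ p) n = (laurent_cst (1 : F) n) *+ p.
  by elim: p {pp pF pg} => [|k IH]; rewrite ?mulr0n// !mulrS fctE IH.
by rewrite -mulr_natr (pcharf0 pF) mulr0.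
Qed.

Lemma frobD z w : (z + w) ^+ q = z ^+ q + w ^+ q.
Proof. exact: exprDn_pchar pchar_nat_q. Qed.

Lemma frob0 : (0 : C) ^+ q = 0.
Proof. by rewrite expr0n gtn_eqF// q_gt0. Qed.

Lemma frobN z : (- z) ^+ q = - z ^+ q.
Proof.
by apply/eqP; rewrite -subr_eq0 opprK -frobD addNr frob0 eqxx.
Qed.

Lemma frobB z w : (z - w) ^+ q = z ^+ q - w ^+ q.
Proof. by rewrite frobD frobN. Qed.

Lemma frob_sum n (a : 'I_n -> C) :
  (\sum_(i < n) a i) ^+ q = \sum_(i < n) a i ^+ q.
Proof. exact: (big_morph (fun z : C => z ^+ q) frobD frob0). Qed.

Lemma abs_frob_lt z (e : R) : abs (z ^+ q) < e ^+ q -> 0 <= e -> abs z < e.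
Proof. by rewrite absX => h e0; rewrite -(ltr_pXn2r q_gt0)// nnegrE abs_ge0. Qed.

(* The q-th root is unique because q is a power of the characteristic; it
   exists by [qrootK]. *)
Definition qroot z : C := xget 0 [set w | w ^+ q = z].

Lemma abs_cvgD (u v : nat -> C) z w :
  abs_cvg abs u z -> abs_cvg abs v w -> abs_cvg abs (fun n => u n + v n) (z + w).
Proof.
move=> uz vw e e0; have [N hN] := uz e e0; have [M hM] := vw e e0.
exists (maxn N M) => n; rewrite geq_max => /andP[nN nM].
by rewrite opprD addrACA; apply: absDlt; [exact: hN|exact: hM].
Qed.

Lemma abs_cvgZ c (u : nat -> C) z :
  abs_cvg abs u z -> abs_cvg abs (fun n => c * u n) (c * z).
Proof.
move=> uz e e0; have c1 : 0 < abs c + 1 by rewrite ltr_wpDl ?abs_ge0.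
have [N hN] := uz _ (divr_gt0 e0 c1); exists N => n /hN.
rewrite ltr_pdivlMr// -mulrBr absM => h.
apply: le_lt_trans h; rewrite mulrC ler_wpM2l ?abs_ge0// lerDl//.
Qed.

Lemma abs_cvg_frob (u : nat -> C) z :
  abs_cvg abs u z -> abs_cvg abs (fun n => u n ^+ q) (z ^+ q).
Proof.
move=> uz e e0; have m0 : 0 < Num.min e 1 by rewrite lt_min e0 ltr01.
have [N hN] := uz _ m0; exists N => n /hN; rewrite lt_min => /andP[h h1].
rewrite -frobB absX; apply: le_lt_trans h.
by rewrite ler_iXnr ?q_gt0// ?abs_ge0// ltW.
Qed.

Lemma abs_cvg_root (u : nat -> C) z :
  abs_cvg abs (fun n => u n ^+ q) (z ^+ q) -> abs_cvg abs u z.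
Proof.
move=> uz e e0; have [N hN] := uz _ (exprn_gt0 q e0).
by exists N => n /hN; rewrite -frobB => /abs_frob_lt; apply; exact: ltW.
Qed.

Lemma abs_cvg_unique (u : nat -> C) z w :
  abs_cvg abs u z -> abs_cvg abs u w -> z = w.
Proof.
move=> uz uw; apply/eqP; rewrite -subr_eq0; apply/eqP/abs0P/eqP.
rewrite eq_le abs_ge0 andbT leNgt; apply/negP => e0.
have [N hN] := uz _ e0; have [M hM] := uw _ e0.
have h1 := hM _ (leq_maxr N M); have h2 := hN _ (leq_maxl N M).
rewrite -absN in h2; have := absDlt h1 h2.
have -> : u (maxn N M) - w - (u (maxn N M) - z) = z - w by ring.
by rewrite ltxx.
Qed.

Lemma qroot_exists z : exists w, w ^+ q = z.
Proof.
have hz n : exists w : ac_field C, abs (z - cc_in C (w ^+ q)) < n.+1%:R^-1.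
  have [|v hv] := cc_dense z (e := n.+1%:R^-1); first by rewrite invr_gt0 ltr0n.
  have [w hw] := @GRing.solve_monicpoly _ q (fun i => if i == 0%N then v else 0) q_gt0.
  exists w; rewrite hw; case: q q_gt0 => // k _.
  rewrite big_ord_recl /= expr0 mulr1 big1 ?addr0// => i _.
  by rewrite mul0r.
have [w hw] := choice hz.
have cw : abs_cvg abs (fun n => cc_in C (w n) ^+ q) z.
  move=> e e0; exists (Num.bound e^-1) => n len.
  rewrite -rmorphXn -absN opprB; apply: lt_trans (hw n) _.
  rewrite invf_plt ?posrE ?ltr0n//.
  apply: lt_le_trans (archi_boundP _) _; first by rewrite invr_ge0 ltW.
  by rewrite ler_nat ltnW// ltnS.
have [|l hl] := @cc_complete _ _ C (fun n => cc_in C (w n)).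
  move=> e e0; have [N hN] := cw _ (exprn_gt0 q e0).
  exists N => m n Nm Nn; apply: abs_frob_lt; last exact: ltW.
  rewrite frobB -[X in X - _](subrK z) -addrA; apply: absDlt; first exact: hN.
  by rewrite -absN opprD opprK addrC; exact: hN.
by exists l; apply: abs_cvg_unique cw; exact: abs_cvg_frob.
Qed.

Lemma qrootK z : qroot z ^+ q = z.
Proof. exact: (xgetPex 0 (P := [set w | w ^+ q = z]) (qroot_exists z)). Qed.

Definition near0 (P : C -> Prop) : Prop :=
  exists2 r : R, 0 < r & forall s, abs s < r -> P s.

Lemma near0I (P Q : C -> Prop) : near0 P -> near0 Q -> near0 (fun s => P s /\ Q s).
Proof.
move=> [r r0 Pr] [t t0 Qt]; exists (Num.min r t); first by rewrite lt_min r0.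
by move=> s; rewrite lt_min => /andP[/Pr ? /Qt].
Qed.

Lemma near0W (P Q : C -> Prop) : (forall s, P s -> Q s) -> near0 P -> near0 Q.
Proof. by move=> PQ [r r0 Pr]; exists r => // s /Pr/PQ. Qed.

Lemma near0_x (P : C -> Prop) : near0 P -> near0 (fun s => P (x * s)).
Proof.
by move=> [r r0 Pr]; exists r => // s sr; apply/Pr/(le_lt_trans _ sr)/abs_x_mul.
Qed.

(* Germs at the origin of arbitrary functions on C, among which F1 is singled
   out below; the codomain C^o makes the functions a C-module. *)
Definition germ_rel : rel (C -> C^o) :=
  fun f g => `[< near0 (fun s => f s = g s) >].

Fact germ_rel_refl : reflexive germ_rel.
Proof. by move=> f; apply/asboolP; exists 1 => //; exact: ltr01. Qed.

Fact germ_rel_sym : symmetric germ_rel.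
Proof.
by move=> f g; apply/asboolP/asboolP; apply: near0W => s ->.
Qed.

Fact germ_rel_trans : transitive germ_rel.
Proof.
move=> g f h /asboolP fg /asboolP gh; apply/asboolP.
by apply: near0W (near0I fg gh) => s [-> ->].
Qed.

Canonical germ_equiv :=
  EquivRel germ_rel germ_rel_refl germ_rel_sym germ_rel_trans.

Definition germ := {eq_quot germ_equiv}%qT.
HB.instance Definition _ := EqQuotient.on germ.
HB.instance Definition _ := Choice.on germ.

Definition germ_of f : germ := \pi_germ%qT f.

Lemma germ_ofP f g : germ_of f = germ_of g <-> near0 (fun s => f s = g s).
Proof. by split => [/eqmodP/asboolP|h]//; apply/eqmodP/asboolP. Qed.

Lemma germ_ofK (u : germ) : germ_of (repr u) = u.
Proof. exact: reprK. Qed.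

Lemma near_repr f : near0 (fun s => (repr (germ_of f) : C -> C^o) s = f s).
Proof. by apply/germ_ofP; rewrite germ_ofK. Qed.

Definition germ_zero : germ := germ_of 0.
Definition germ_opp (u : germ) : germ := germ_of (- repr u).
Definition germ_add (u v : germ) : germ := germ_of (repr u + repr v).
Definition germ_scale (c : C) (u : germ) : germ := germ_of (c *: (repr u : C -> C^o)).

Lemma germ_addE f g : germ_add (germ_of f) (germ_of g) = germ_of (f + g).
Proof.
apply/germ_ofP; apply: near0W (near0I (near_repr f) (near_repr g)) => s [fs gs].
by rewrite !fctE fs gs.
Qed.

Lemma germ_oppE f : germ_opp (germ_of f) = germ_of (- f).
Proof.
by apply/germ_ofP; apply: near0W (near_repr f) => s fs; rewrite !fctE fs.
Qed.

Lemma germ_scaleE c f : germ_scale c (germ_of f) = germ_of (c *: f).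
Proof.
by apply/germ_ofP; apply: near0W (near_repr f) => s fs; rewrite !fctE fs.
Qed.

Lemma germP (P : germ -> Prop) : (forall f, P (germ_of f)) -> forall u, P u.
Proof. by move=> h u; rewrite -[u]germ_ofK. Qed.

Fact germ_addA : associative germ_add.
Proof.
by elim/germP => f; elim/germP => g; elim/germP => h; rewrite !germ_addE addrA.
Qed.

Fact germ_addC : commutative germ_add.
Proof. by elim/germP => f; elim/germP => g; rewrite !germ_addE addrC. Qed.

Fact germ_add0 : left_id germ_zero germ_add.
Proof. by elim/germP => f; rewrite germ_addE add0r. Qed.

Fact germ_addN : left_inverse germ_zero germ_opp germ_add.
Proof. by elim/germP => f; rewrite germ_oppE germ_addE addNr. Qed.

HB.instance Definition _ :=
  GRing.isZmodule.Build germ germ_addA germ_addC germ_add0 germ_addN.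

Lemma germ_ofD f g : germ_of f + germ_of g = germ_of (f + g).
Proof. exact: germ_addE. Qed.

Fact germ_scaleA a b (u : germ) :
  germ_scale a (germ_scale b u) = germ_scale (a * b) u.
Proof. by elim/germP: u => f; rewrite !germ_scaleE scalerA. Qed.

Fact germ_scale1 : left_id 1 germ_scale.
Proof. by elim/germP => f; rewrite germ_scaleE scale1r. Qed.

Fact germ_scaleDr : right_distributive germ_scale +%R.
Proof.
move=> c; elim/germP => f; elim/germP => g.
by rewrite germ_ofD !germ_scaleE germ_ofD scalerDr.
Qed.

Fact germ_scaleDl (u : germ) : {morph germ_scale^~ u : a b / a + b}.
Proof.
move=> a b; elim/germP: u => f.
by rewrite !germ_scaleE germ_ofD scalerDl.
Qed.

HB.instance Definition _ := GRing.Zmodule_isLmodule.Build C germ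
  germ_scaleA germ_scale1 germ_scaleDr germ_scaleDl.

(* f is, near 0, the sum of a convergent F_q-linear power series
   sum_m a_m s^(q^m). *)
Definition linear_series f : Prop := exists a : nat -> C,
  near0 (fun s => abs_cvg abs (fun n => \sum_(m < n) a m * s ^+ (q ^ m)) (f s)).

Definition linear_germ : {pred germ} :=
  fun u => `[< exists2 f, linear_series f & u = germ_of f >].

Lemma linear_germP f : germ_of f \in linear_germ <-> linear_series f.
Proof.
split=> [/asboolP[g [a ag] /germ_ofP fg]|]; last by move=> ?; apply/asboolP; exists f.
by exists a; apply: near0W (near0I ag fg) => s [ags ->].
Qed.

Fact linear_germ_submod : submod_closed linear_germ.
Proof.
split.
  apply/linear_germP; exists (fun=> 0); exists 1 => // s _ e e0; exists 0%N => n _.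
  by rewrite -[X in _ - X]/(0 : C) big1 ?subr0 ?abs0// => i _; rewrite mul0r.
move=> c; elim/germP => f; elim/germP => g /linear_germP[a fa] /linear_germP[b gb].
have -> : c *: germ_of f + germ_of g = germ_of (c *: f + g).
  by rewrite [c *: _]germ_scaleE germ_ofD.
apply/linear_germP; exists (fun m => c * a m + b m).
apply: near0W (near0I fa gb) => s [fs gs]; rewrite !fctE.
have /= := abs_cvgD (abs_cvgZ c fs) gs; congr abs_cvg; apply/funext => n.
by rewrite mulr_sumr -big_split /=; apply: eq_bigr => i _; rewrite mulrDl mulrA.
Qed.
HB.instance Definition _ :=
  GRing.isSubmodClosed.Build _ _ linear_germ linear_germ_submod.

Record F1 := MkF1 { F1_germ :> germ; _ : F1_germ \in linear_germ }.
HB.instance Definition _ := [isSub for F1_germ].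
HB.instance Definition _ := [Choice of F1 by <:].
HB.instance Definition _ := [SubChoice_isSubLmodule of F1 by <:].

(* tau and ds act on functions by the formulas below; [germ_tauE] and [germ_dsE]
   show that the germ of the result depends only on the germ of the argument. *)
Definition tau_fun f : C -> C^o := fun s => f s ^+ q.
Definition ds_fun f : C -> C^o := fun s => qroot (f (x * s) - x * f s).

Definition germ_tau (u : germ) : germ := germ_of (tau_fun (repr u)).
Definition germ_ds (u : germ) : germ := germ_of (ds_fun (repr u)).

Lemma germ_tauE f : germ_tau (germ_of f) = germ_of (tau_fun f).
Proof.
by apply/germ_ofP; apply: near0W (near_repr f) => s fs; rewrite /tau_fun fs.
Qed.

Lemma germ_dsE f : germ_ds (germ_of f) = germ_of (ds_fun f).
Proof.
apply/germ_ofP; apply: near0W (near0I (near_repr f) (near0_x (near_repr f))) => s.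
by move=> [fs fxs]; rewrite /ds_fun fs fxs.
Qed.

Fact tau_subproof (u : F1) : germ_tau u \in linear_germ.
Proof.
case: u => /=; elim/germP => f /linear_germP[a fa]; rewrite germ_tauE.
apply/linear_germP; exists (fun m => if m is k.+1 then a k ^+ q else 0).
apply: near0W fa => s fs e e0; have [N hN] := abs_cvg_frob fs e0.
exists N.+1 => -[//|n] Nn.
rewrite (_ : \sum_(m < n.+1) _ = (\sum_(m < n) a m * s ^+ (q ^ m)) ^+ q).
  exact: hN.
rewrite frob_sum big_ord_recl mul0r add0r; apply: eq_bigr => i _ /=.
by rewrite exprMn -exprM expnSr.
Qed.
Definition tau (u : F1) : F1 := MkF1 (tau_subproof u).

Fact ds_subproof (u : F1) : germ_ds u \in linear_germ.
Proof.
case: u => /=; elim/germP => f /linear_germP[a fa]; rewrite germ_dsE.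
apply/linear_germP.
exists (fun m => qroot (a m.+1 * (x ^+ (q ^ m.+1) - x))).
apply: near0W (near0I fa (near0_x fa)) => s [fs fxs].
apply: abs_cvg_root => e e0; rewrite qrootK.
have [N hN] := abs_cvgD fxs (abs_cvgZ (- x) fs) e0.
exists N => n Nn; rewrite (_ : _ ^+ q = \sum_(m < n.+1) a m * (x * s) ^+ (q ^ m)
    + - x * \sum_(m < n.+1) a m * s ^+ (q ^ m)).
  by rewrite -mulNr; exact: hN (leqW Nn).
apply/esym; rewrite frob_sum mulr_sumr -big_split big_ord_recl /=.
rewrite expn0 !expr1 [X in X + _](_ : _ = 0) ?add0r; last by ring.
apply: eq_bigr => i _; rewrite [RHS]exprMn qrootK -exprM -expnSr exprMn.
by rewrite /bump /= add1n; ring.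
Qed.
Definition ds (u : F1) : F1 := MkF1 (ds_subproof u).

(* The subring generated by tau, ds and the scalars, inside all maps F1 -> F1
   with pointwise subtraction and composition (1 is the scalar 1). *)
Inductive carlitz_ring : (F1 -> F1) -> Prop :=
| carlitz_tau : carlitz_ring tau
| carlitz_ds : carlitz_ring ds
| carlitz_scale c : carlitz_ring ( *:%R c)
| carlitz_sub phi psi :
    carlitz_ring phi -> carlitz_ring psi -> carlitz_ring (fun u => phi u - psi u)
| carlitz_comp phi psi :
    carlitz_ring phi -> carlitz_ring psi -> carlitz_ring (phi \o psi).

End CarlitzRing.

Definition lin_span (k : fieldType) (V : lmodType k) (A : set V) : set V :=
  [set v | exists n (c : 'I_n -> k) (a : 'I_n -> V),
     (forall i, A (a i)) /\ v = \sum_(i < n) c i *: a i].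

Definition has_dim (k : fieldType) (V : lmodType k) (U : set V) (n : nat) : Prop :=
  exists b : 'I_n -> V,
    (forall c : 'I_n -> k, \sum_(i < n) c i *: b i = 0 -> forall i, c i = 0) /\
    lin_span (range b) = U.

Section QuasiHolonomic.
Variables (R : realType) (F : finFieldType) (C : completed_closure R F).

Definition carlitz_filtration (f : F1 C) (j : nat) : set (F1 C) :=
  lin_span [set u | exists l m, (l + m <= j)%N /\
                      u = iter l (@tau R F C) (iter m (@ds R F C) f)].

(* d is the degree of the (unique) polynomial that gives the dimension of the
   j-th filtration step for all large j. *)
Definition GK_dim (f : F1 C) (d : nat) : Prop :=
  exists chi : {poly rat}, size chi = d.+1 /\
    exists J : nat, forall j, (J <= j)%N ->
      exists n : nat, has_dim (carlitz_filtration f j) n /\ n%:R = chi.[j%:R].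

Definition quasi_holonomic (f : F1 C) : Prop := GK_dim f 1.

End QuasiHolonomic.

(* Main.v *)
Require Import Defs.
From mathcomp Require Import all_boot all_order all_algebra all_field.
From mathcomp Require Import all_classical reals.
From mathcomp Require Import zify ring.
Import GRing.Theory.
Local Open Scope ring_scope.

(** Order the monomials [tau^l ds^m] by degree [l + m], and by [l] inside one
degree, and call such a monomial redundant when its value at [f] is a linear
combination of the values of the preceding ones.  The monomials of degree at
most [j] that are not redundant give a basis of the filtration step, so its
dimension is the sum of the numbers [h(d)] of standard (that is, non-redundant)
monomials of degree [d <= j] ([staircase_dim]).

Redundancy is stable under [(l, m) -> (l.+1, m)] and [(l, m) -> (l, m.+1)].
Indeed [tau] and [ds] are additive and semilinear, hence carry linear relations
to linear relations, and the commutation rule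
[ds tau^l = tau^l ds + b tau^(l-1)] only creates a monomial of lower degree
([redundant_tau], [redundant_ds]).  So one redundant monomial of degree [d]
makes [h] non-increasing from [d] on ([standard_count_leq]); being a sequence
of natural numbers, [h] is then eventually equal to some constant [c], and the
dimension is eventually an affine function of [j] with slope [c].

A redundant monomial exists: the commutation rule puts [phi] into the form of a
linear combination of monomials ([carlitz_ring_normal_form]), some coefficient
is non-zero because [phi] is, and the relation [phi f = 0] expresses the value
of the last monomial that occurs through the preceding ones
([annihilator_redundant]).

Finally [c] is not zero, as the vectors [tau^i f] are linearly independent
([tau_iter_free]).  A relation between them reads [P(f(s)) = 0] near the origin
for a non-zero polynomial [P]; since [f(s)] tends to [0] with [s] and the roots
of [P] are isolated, [f] would vanish near the origin. *)
Set Implicit Arguments.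
Unset Strict Implicit.
Unset Printing Implicit Defensive.

Import Order.TTheory Num.Theory.
Local Open Scope classical_set_scope.

(** * Spans and dimensions *)
Section LinearSpan.
Context {k : fieldType} {V : lmodType k}.
Implicit Types (A B U : set V) (u v w : V).

Lemma lin_span0 A : lin_span A 0.
Proof.
exists 0%N, (fun=> 0), (fun=> 0); split; first by case.
by rewrite big_ord0.
Qed.

Lemma lin_span_cons A a v c : A a -> lin_span A v -> lin_span A (c *: a + v).
Proof.
move=> Aa [n [d [b [Ab ->]]]].
exists n.+1, (fun i => oapp d c (unlift ord0 i)), (fun i => oapp b a (unlift ord0 i)).
split=> [i|]; first by case: unlift => /=.
rewrite big_ord_recl unlift_none; congr (_ + _).
by apply: eq_bigr => i _; rewrite liftK.
Qed.

Lemma lin_span_ind A (P : V -> Prop) : P 0 ->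
  (forall c a v, A a -> lin_span A v -> P v -> P (c *: a + v)) ->
  forall v, lin_span A v -> P v.
Proof.
move=> P0 Pc v [n [c [a [Aa ->]]]].
elim: n => [|n IH] in c a Aa *; first by rewrite big_ord0.
rewrite big_ord_recl; apply: Pc => //; last exact: IH.
by exists n, (c \o lift ord0), (a \o lift ord0); split => // i; exact: Aa.
Qed.

Lemma sub_lin_span A : A `<=` lin_span A.
Proof.
move=> a Aa; rewrite -[a]scale1r -[_ *: _]addr0.
by apply: lin_span_cons => //; exact: lin_span0.
Qed.

Lemma lin_spanD A u v : lin_span A u -> lin_span A v -> lin_span A (u + v).
Proof.
move=> Au Av; elim/lin_span_ind: Au => [|c a w Aa _ IH]; first by rewrite add0r.
by rewrite -addrA; exact: lin_span_cons.
Qed.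

Lemma lin_spanZ A c u : lin_span A u -> lin_span A (c *: u).
Proof.
elim/lin_span_ind => [|d a w Aa _ IH]; first by rewrite scaler0; exact: lin_span0.
by rewrite scalerDr scalerA; exact: lin_span_cons.
Qed.

Lemma lin_spanN A u : lin_span A u -> lin_span A (- u).
Proof. by rewrite -scaleN1r; exact: lin_spanZ. Qed.

Lemma lin_span_sub A B : A `<=` lin_span B -> lin_span A `<=` lin_span B.
Proof.
move=> AB v; elim/lin_span_ind => [|c a w Aa _ IH]; first exact: lin_span0.
by apply: lin_spanD => //; apply: lin_spanZ; exact: AB.
Qed.

Lemma lin_span_setU1 A v w : lin_span (A `|` [set v]) w ->
  exists c u, lin_span A u /\ w = c *: v + u.
Proof.
elim/lin_span_ind => [|c a _ Aa _ [d [u [Au ->]]]].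
  by exists 0, 0; split; [exact: lin_span0|rewrite scale0r addr0].
case: Aa => [Aa|->]; last by exists (c + d), u; rewrite scalerDl addrA.
by exists d, (c *: a + u); split; [exact: lin_span_cons|rewrite addrCA].
Qed.

Lemma lin_span_range n (b : 'I_n -> V) v :
  lin_span (range b) v -> exists c : 'I_n -> k, v = \sum_i c i *: b i.
Proof.
elim/lin_span_ind => [|c _ _ [i _ <-] _ [d ->]].
  by exists (fun=> 0); rewrite big1 // => i _; rewrite scale0r.
exists (fun j => (if j == i then c else 0) + d j).
under [RHS]eq_bigr do rewrite scalerDl.
rewrite big_split /=; congr (_ + _).
rewrite (bigD1 i) //= eqxx big1 ?addr0 // => j /negPf ->.
by rewrite scale0r.
Qed.

Lemma lin_span_set0 v : lin_span set0 v -> v = 0.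
Proof. by elim/lin_span_ind. Qed.

Lemma has_dim0 : has_dim (lin_span (set0 : set V)) 0.
Proof.
exists (fun=> 0); split; first by move=> c _; case.
apply/seteqP; split; apply: lin_span_sub; last by [].
by move=> v [i]; case: i.
Qed.

Lemma has_dim_setU1 A v n : ~ lin_span A v ->
  has_dim (lin_span A) n -> has_dim (lin_span (A `|` [set v])) n.+1.
Proof.
move=> Av [b [free_b spanb]]; pose b' (i : 'I_n.+1) := oapp b v (unlift ord0 i).
have b'0 : b' ord0 = v by rewrite /b' unlift_none.
have b'S i : b' (lift ord0 i) = b i by rewrite /b' liftK.
have sb i : lin_span A (b i) by rewrite -spanb; apply: sub_lin_span; exists i.
exists b'; split=> [c|].
  rewrite big_ord_recl b'0; under eq_bigr do rewrite b'S.
  move=> cb0; have c00 : c ord0 = 0.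
    apply/eqP/negP => /negP c0; apply: Av.
    have -> : v = - (c ord0)^-1 *: \sum_i c (lift ord0 i) *: b i.
      move/eqP: cb0; rewrite addr_eq0 => /eqP cb0.
      by rewrite scaleNr -scalerN -cb0 scalerA mulVf // scale1r.
    apply: lin_spanZ; rewrite -spanb.
    by exists n, (fun i => c (lift ord0 i)), b; split => // i; exists i.
  move: cb0; rewrite c00 scale0r add0r => /free_b c0 i.
  by case: (unliftP ord0 i) => [j|] ->.
apply/seteqP; split; apply: lin_span_sub => w.
  move=> [i _ <-]; case: (unliftP ord0 i) => [j|] ->; rewrite ?b'0 ?b'S.
    by apply: lin_span_sub (sb j) => a Aa; apply: sub_lin_span; left.
  by apply: sub_lin_span; right.
move=> [/sub_lin_span|->]; last by apply: sub_lin_span; exists ord0.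
rewrite -spanb; apply: lin_span_sub => _ [i _ <-].
by apply: sub_lin_span; exists (lift ord0 i).
Qed.

Lemma lin_span_absorb A v : lin_span A v -> lin_span (A `|` [set v]) = lin_span A.
Proof.
move=> Av; apply/seteqP; split; apply: lin_span_sub => w.
  by move=> [/sub_lin_span|->].
by move=> Aw; apply: sub_lin_span; left.
Qed.

(** Expressing the [b i] in a basis of [U] gives an [m x n] matrix, and a row
vector in its kernel is a linear relation between the [b i]. *)
Lemma free_leq_dim U n m (b : 'I_m -> V) : has_dim U n -> (forall i, U (b i)) ->
  (forall c : 'I_m -> k, \sum_i c i *: b i = 0 -> forall i, c i = 0) -> (m <= n)%N.
Proof.
move=> [b0 [_ <-]] Ub free_b.
have [A bA] := choice (fun i => lin_span_range (Ub i)).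
pose M : 'M[k]_(m, n) := \matrix_(i, j) A i j.
suff /eqP <- : row_free M by exact: rank_leq_col.
rewrite -kermx_eq0; apply/rowV0P => u /sub_kermxP uM; apply/rowP => i.
rewrite mxE; apply: (free_b (fun i => u 0 i)).
under eq_bigr do rewrite bA scaler_sumr.
rewrite exchange_big big1 //= => j _; under eq_bigr do rewrite scalerA.
rewrite -scaler_suml; move/rowP/(_ j): uM; rewrite !mxE => uMj.
rewrite [X in X *: _](_ : _ = 0) ?scale0r // -[RHS]uMj.
by apply: eq_bigr => i' _; rewrite mxE.
Qed.

End LinearSpan.

(** [sigma] is the Frobenius map for [tau], its inverse for [ds], and the
identity for the evaluation of operators at a point. *)
Lemma lin_span_semilinear (k : fieldType) (V W : lmodType k) (g : V -> W)
    (sigma : k -> k) (A : set V) (B : set W) :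
  g 0 = 0 -> (forall u v, g (u + v) = g u + g v) ->
  (forall c v, g (c *: v) = sigma c *: g v) ->
  (forall a, A a -> lin_span B (g a)) -> forall v, lin_span A v -> lin_span B (g v).
Proof.
move=> g0 gD gZ gA v; elim/(@lin_span_ind k V A) => [|c a w Aa _ IH].
  by rewrite g0; exact: lin_span0.
by rewrite gD gZ; apply: lin_spanD => //; apply: lin_spanZ; exact: gA.
Qed.

(** * Standard monomials of a doubly indexed family *)
Section Staircase.
Context {k : fieldType} {V : lmodType k} (e : nat -> nat -> V).

(** The pair [(d, l)] stands for the monomial [e l (d - l)].  Values [l > d] are
allowed: [preceding d d.+1] consists of all monomials of degree at most [d],
which makes it equal to [preceding d.+1 0]. *)
Definition preceding (d l : nat) : set V :=
  [set v | exists l' m', ((l' + m' < d) || ((l' + m' == d) && (l' < l)))%N /\ v = e l' m'].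

Definition redundant (d l : nat) : bool :=
  `[< lin_span (preceding d l) (e l (d - l)%N) >].

Definition standard_count (d : nat) : nat := \sum_(l < d.+1) ~~ redundant d l.

Lemma precedingP d l l' m' :
  ((l' + m' < d) || ((l' + m' == d) && (l' < l)))%N -> lin_span (preceding d l) (e l' m').
Proof. by move=> h; apply: sub_lin_span; exists l', m'. Qed.

Lemma preceding0 : preceding 0 0 = set0.
Proof. by apply/seteqP; split => // v [l' [m' [h _]]]; lia. Qed.

Lemma precedingS d l : (l <= d)%N ->
  preceding d l.+1 = preceding d l `|` [set e l (d - l)%N].
Proof.
move=> ld; apply/seteqP; split => v /=.
  move=> [l' [m' [h ->]]].
  case: (eqVneq l' l) h => [->|nl] h; last by left; exists l', m'; split => //; lia.
  case: (eqVneq (l + m')%N d) => [<-|nd]; first by right; rewrite addKn.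
  by left; exists l, m'; split => //; lia.
move=> [[l' [m' [h ->]]]|->]; first by exists l', m'; split => //; lia.
by exists l, (d - l)%N; split => //; lia.
Qed.

Lemma preceding_degreeS d : preceding d d.+1 = preceding d.+1 0.
Proof.
by apply/seteqP; split => v [l' [m' [h ->]]]; exists l', m'; split => //; lia.
Qed.

(** Adding the monomials in order, the dimension grows by one exactly when the
new monomial is not redundant. *)
Lemma staircase_dim d :
  has_dim (lin_span (preceding d 0)) (\sum_(i < d) standard_count i).
Proof.
elim: d => [|d IH]; first by rewrite preceding0 big_ord0; exact: has_dim0.
rewrite -preceding_degreeS big_ord_recr /= /standard_count.
have step l : (l <= d.+1)%N -> has_dim (lin_span (preceding d l))
    (\sum_(i < d) standard_count i + \sum_(i < l) ~~ redundant d i).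
  elim: l => [_|l IHl ld]; first by rewrite big_ord0 addn0.
  rewrite precedingS // big_ord_recr /= addnA.
  have := IHl (ltnW ld); rewrite [redundant d l]/redundant; case: asboolP => [r|nr] h.
    by rewrite lin_span_absorb // addn0.
  by rewrite addn1; exact: has_dim_setU1.
exact: step.
Qed.

Hypothesis redundantSS : forall d l, redundant d l -> redundant d.+1 l.+1.
Hypothesis redundantS : forall d l, (l <= d)%N -> redundant d l -> redundant d.+1 l.

(** Fix the redundant monomial [l] of degree [d]; it stays redundant in degree
[d.+1].  The map [lift l] identifies the other indices of degree [d.+1] with
those of degree [d], and as [lift l i] is [i] or [i.+1], it sends redundant
indices to redundant ones. *)
Lemma standard_count_leq d l : (l <= d)%N -> redundant d l ->
  (standard_count d.+1 <= standard_count d)%N.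
Proof.
move=> ld rl; rewrite /standard_count.
pose l0 : 'I_d.+2 := inord l.
have l0E : l0 = l :> nat by rewrite inordK // ltnW.
rewrite (bigD1_ord l0) //= l0E redundantS // add0n.
have impl (r r' : bool) : (r -> r') -> (~~ r' <= ~~ r)%N.
  by case: r; case: r' => //= /(_ isT).
apply: leq_sum => i _; have id : (i <= d)%N by rewrite -ltnS.
have [->|->] : bump l i = i.+1 \/ bump l i = i by rewrite /bump; lia.
  by apply: impl; exact: redundantSS.
by apply: impl; exact: redundantS.
Qed.

Lemma redundant_later d l j : (l <= d)%N -> redundant d l -> (d <= j)%N -> redundant j l.
Proof.
move=> ld r; elim: j => [|j IH]; first by rewrite leqn0 => /eqP <-.
rewrite leq_eqVlt => /orP[/eqP <-//|dj].
by apply: redundantS (IH dj); exact: leq_trans ld dj.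
Qed.

End Staircase.

Lemma nonincreasing_stationary (h : nat -> nat) d :
  (forall j, (d <= j)%N -> (h j.+1 <= h j)%N) ->
  exists c J, forall j, (J <= j)%N -> h j = c.
Proof.
have [n] := ubnP (h d); elim: n d => // n IH d hn hd.
have [[j dj hj]|no] := pselect (exists2 j, (d <= j)%N & (h j < h d)%N).
  apply: (IH j); first by rewrite (leq_trans hj).
  by move=> i ji; apply: hd; exact: leq_trans ji.
exists (h d), d => j dj; apply/eqP; rewrite eqn_leq; apply/andP; split.
  elim: j dj => [|j IHj]; first by rewrite leqn0 => /eqP ->.
  rewrite leq_eqVlt => /orP[/eqP <-//|dj].
  exact: leq_trans (hd _ dj) (IHj dj).
by rewrite leqNgt; apply/negP => hj; apply: no; exists j.
Qed.

Lemma sum_stationary (h : nat -> nat) c J : (forall j, (J <= j)%N -> h j = c) ->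
  forall j, (J <= j)%N -> (\sum_(i < j) h i + c * J = \sum_(i < J) h i + c * j)%N.
Proof.
move=> hc; elim=> [|j IH]; first by rewrite leqn0 => /eqP ->.
rewrite leq_eqVlt => /orP[/eqP <-//|Jj].
by rewrite big_ord_recr /= addnAC IH // hc // mulnS addnAC addnA.
Qed.

(** * Algebra of the Carlitz operators *)
Section CarlitzOperators.
Context {R : realType} {F : finFieldType} {C : completed_closure R F}.

Local Notation q := #|F|.
Local Notation abs := (@cc_abs R F C).
Local Notation x := (cc_in C (ac_in C (laurentX F))).
Local Notation tau := (@tau R F C).
Local Notation ds := (@ds R F C).
Implicit Types (z w s : C) (u v : F1 C).

Lemma frob_inj : injective (fun z => z ^+ q).
Proof.
move=> z w /= zw; apply/eqP; rewrite -subr_eq0.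
have : (z - w) ^+ q == 0 by rewrite frobB zw subrr.
by rewrite expf_eq0 => /andP[].
Qed.

Lemma qrootD z w : qroot (z + w) = qroot z + qroot w.
Proof. by apply: frob_inj; rewrite frobD !qrootK. Qed.

Lemma qrootM z w : qroot (z * w) = qroot z * qroot w.
Proof. by apply: frob_inj; rewrite exprMn !qrootK. Qed.

Lemma F1_eqP (f g : C -> C^o) u v : F1_germ u = germ_of f -> F1_germ v = germ_of g ->
  f =1 g -> u = v.
Proof. by move=> uf vg /funext fg; apply: val_inj; rewrite /= uf vg fg. Qed.

Lemma F1_repr u : exists f : C -> C^o, F1_germ u = germ_of f.
Proof. by exists (repr (F1_germ u)); rewrite germ_ofK. Qed.

Lemma tau_germ u f : F1_germ u = germ_of f -> F1_germ (tau u) = germ_of (tau_fun f).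
Proof. by rewrite /= => ->; exact: germ_tauE. Qed.

Lemma ds_germ u f : F1_germ u = germ_of f -> F1_germ (ds u) = germ_of (ds_fun f).
Proof. by rewrite /= => ->; exact: germ_dsE. Qed.

Lemma addF1_germ u v f g : F1_germ u = germ_of f -> F1_germ v = germ_of g ->
  F1_germ (u + v) = germ_of (f + g).
Proof. by move=> uf vg; rewrite -germ_ofD -uf -vg. Qed.

Lemma scaleF1_germ c u f : F1_germ u = germ_of f -> F1_germ (c *: u) = germ_of (c *: f).
Proof. by move=> uf; rewrite -germ_scaleE -uf. Qed.

Lemma tauD u v : tau (u + v) = tau u + tau v.
Proof.
have [f uf] := F1_repr u; have [g vg] := F1_repr v.
apply: (F1_eqP (tau_germ (addF1_germ uf vg)) (addF1_germ (tau_germ uf) (tau_germ vg))).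
by move=> s; exact: frobD.
Qed.

Lemma tauZ c u : tau (c *: u) = c ^+ q *: tau u.
Proof.
have [f uf] := F1_repr u.
apply: (F1_eqP (tau_germ (scaleF1_germ c uf)) (scaleF1_germ _ (tau_germ uf))).
by move=> s; exact: exprMn.
Qed.

Lemma dsD u v : ds (u + v) = ds u + ds v.
Proof.
have [f uf] := F1_repr u; have [g vg] := F1_repr v.
apply: (F1_eqP (ds_germ (addF1_germ uf vg)) (addF1_germ (ds_germ uf) (ds_germ vg))).
by move=> s; rewrite -[RHS]qrootD; congr qroot; rewrite !fctE; ring.
Qed.

Lemma dsZ c u : ds (c *: u) = qroot c *: ds u.
Proof.
have [f uf] := F1_repr u.
apply: (F1_eqP (ds_germ (scaleF1_germ c uf)) (scaleF1_germ _ (ds_germ uf))).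
move=> s; rewrite -[RHS]qrootM; congr qroot.
rewrite -[X in X - _]/(c * f (x * s)) -[X in _ - x * X]/(c * f s); ring.
Qed.

Lemma tau0 : tau 0 = 0.
Proof. by apply: (addrI (tau 0)); rewrite -tauD !addr0. Qed.

Lemma ds0 : ds 0 = 0.
Proof. by apply: (addrI (ds 0)); rewrite -dsD !addr0. Qed.

(** This holds for germs of arbitrary functions:
[ds (tau f) (s) = f(xs) - x^(1/q) f(s)] and [tau (ds f) (s) = f(xs) - x f(s)]. *)
Lemma ds_tau u : ds (tau u) = tau (ds u) + (x - qroot x) *: u.
Proof.
have [f uf] := F1_repr u.
apply: (F1_eqP (ds_germ (tau_germ uf))
  (addF1_germ (tau_germ (ds_germ uf)) (scaleF1_germ _ uf))) => s.
rewrite -[RHS]/(qroot (f (x * s) - x * f s) ^+ q + (x - qroot x) * f s) qrootK.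
rewrite -[LHS]/(qroot (f (x * s) ^+ q - x * f s ^+ q)).
apply: frob_inj; rewrite qrootK.
have -> : f (x * s) - x * f s + (x - qroot x) * f s = f (x * s) - qroot x * f s.
  by ring.
by rewrite frobB exprMn qrootK.
Qed.

Lemma ds_iter_tau l : exists b : C, forall u,
  ds (iter l.+1 tau u) = iter l.+1 tau (ds u) + b *: iter l tau u.
Proof.
elim: l => [|l [b IH]]; first by exists (x - qroot x) => u; exact: ds_tau.
exists (b ^+ q + (x - qroot x)) => u.
by rewrite [iter l.+2 _ _]iterS ds_tau IH tauD tauZ -addrA -scalerDl.
Qed.


(** * Behaviour of linear series near the origin *)
Lemma small_point (r : R) : 0 < r -> exists2 z, z != 0 & abs z < r.
Proof.
move=> r0; have x0 : x != 0.
  apply/eqP => /(abs0P (C := C)); rewrite abs_x => /eqP.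
  by rewrite invr_eq0 pnatr_eq0 -leqn0 leqNgt q_gt0.
exists (x ^+ Num.bound r^-1); first exact: expf_neq0.
rewrite absX abs_x exprVn invf_plt ?posrE //; last by rewrite exprn_gt0 // ltr0n q_gt0.
apply: lt_trans (archi_boundP _) _; first by rewrite invr_ge0 ltW.
by rewrite -natrX ltr_nat ltn_expl // q_gt1.
Qed.

(** The terms of a convergent series tend to [0]: here, all those from [N] on
have absolute value less than [1], and the others are finitely many. *)
Lemma abs_cvg_terms_bounded (t : nat -> C) z :
  abs_cvg abs (fun n => \sum_(m < n) t m) z ->
  exists2 B : R, 0 < B & forall m, abs (t m) <= B.
Proof.
move=> tz; have [N hN] := tz 1 ltr01.
have h0 : 0 <= \sum_(m < N) abs (t m) by apply: sumr_ge0 => m _; exact: abs_ge0.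
exists (1 + \sum_(m < N) abs (t m)) => [|m]; first by rewrite ltr_pwDl.
have [Nm|mN] := leqP N m.
  apply: ler_wpDr => //; apply: ltW.
  have -> : t m = (\sum_(i < m.+1) t i - z) + - (\sum_(i < m) t i - z).
    by rewrite big_ord_recr /=; ring.
  by apply: absDlt; [exact: hN (leqW Nm)|rewrite absN; exact: hN].
rewrite (bigD1 (Ordinal mN)) //= addrCA lerDl addr_ge0 //.
by apply: sumr_ge0 => i _; exact: abs_ge0.
Qed.

(** If the series converges at [z != 0], then [|a m z^(q^m)| <= B] for all [m],
so for [|s| < |z|] each term at [s] is at most [B |s / z|^(q^m) <= B |s / z|]
in absolute value, and the ultrametric inequality bounds [f s] by the same
quantity. *)
Lemma linear_series_cvg0 (f : C -> C^o) (e : R) : linear_series f -> 0 < e ->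
  near0 (fun s => abs (f s) < e).
Proof.
move=> [a [r r0 fa]] e0; have [z z0 zr] := small_point r0.
have [B B0 hB] := abs_cvg_terms_bounded (t := fun m => a m * z ^+ (q ^ m)) (fa _ zr).
have az0 : 0 < abs z by rewrite lt_def abs_ge0 andbT; apply: contra_neq z0 => /abs0P.
exists (Num.min (Num.min r (abs z)) (e / B * abs z)).
  by rewrite !lt_min r0 az0 mulr_gt0 // divr_gt0.
move=> s; rewrite !lt_min => /andP[/andP[sr sz] se].
pose t := s / z; have tz : s = t * z by rewrite /t divfK.
have t1 : abs t < 1 by rewrite -(ltr_pM2r az0) -absM -tz mul1r.
have tB : abs t * B < e.
  by rewrite -ltr_pdivlMr // -(ltr_pM2r az0) -absM -tz.
have [N hN] := fa _ sr e e0.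
have -> : f s = - (\sum_(m < N) a m * s ^+ (q ^ m) - f s)
    + \sum_(m < N) a m * s ^+ (q ^ m).
  by ring.
apply: absDlt; first by rewrite absN; exact: hN.
elim/big_ind: _ => [|u v|m _]; [by rewrite abs0|exact: absDlt|].
rewrite tz exprMn mulrCA absM; apply: le_lt_trans tB.
apply: ler_pM; rewrite ?abs_ge0 // absX.
by apply: ler_iXnr; rewrite ?abs_ge0 ?expn_gt0 ?q_gt0 // ltW.
Qed.

Lemma poly_bounded (p : {poly C}) :
  exists2 B : R, 0 < B & forall z, abs z <= 1 -> abs p.[z] <= B.
Proof.
elim/poly_ind: p => [|p c [B B0 hB]].
  by exists 1 => // z _; rewrite horner0 abs0.
exists (Num.max B (abs c)) => [|z z1]; first by rewrite lt_max B0.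
rewrite hornerMXaddC; apply: le_trans (absD_max _ _) _.
rewrite ge_max !le_max lexx orbT andbT absM.
by rewrite -[B]mulr1 ler_pM ?abs_ge0 // hB.
Qed.

(** Dividing by a power of the variable, one may assume that the constant term
[c] is non-zero; for small [z] it then dominates the rest of the polynomial. *)
Lemma poly_no_small_root (p : {poly C}) : p != 0 ->
  near0 (fun z : C => p.[z] = 0 -> z = 0).
Proof.
elim/poly_ind: p => [|p c IH]; first by rewrite eqxx.
have [-> {c}|c0 _] := eqVneq c 0.
  rewrite addr0 => pX; have [r r0 hr] : near0 (fun z : C => p.[z] = 0 -> z = 0).
    by apply: IH; apply: contra_neq pX => ->; rewrite mul0r.
  exists r => // z /hr hz; rewrite hornerMX => /eqP.
  by rewrite mulf_eq0 => /orP[] /eqP.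
have [B B0 hB] := poly_bounded p.
have ac0 : 0 < abs c by rewrite lt_def abs_ge0 andbT; apply: contra_neq c0 => /abs0P.
exists (Num.min 1 (abs c / B)); first by rewrite lt_min ltr01 divr_gt0.
move=> z; rewrite lt_min => /andP[z1 zc]; rewrite hornerMXaddC => /eqP.
rewrite addrC addr_eq0 => /eqP cE; move: zc.
rewrite ltr_pdivlMr // cE absN absM mulrC ltNge ler_wpM2r ?abs_ge0 //.
by apply: hB; exact: ltW.
Qed.

Lemma tau_iter_germ l u f : F1_germ u = germ_of f ->
  F1_germ (iter l tau u) = germ_of (fun s => f s ^+ (q ^ l)).
Proof.
move=> uf; elim: l => [|l IH].
  by rewrite uf; congr germ_of; apply/funext => s; rewrite expn0 expr1.
rewrite iterS (tau_germ IH); congr germ_of; apply/funext => s.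
by rewrite /tau_fun -exprM expnSr.
Qed.

(** The relation says that [f(s)] is a root of [P = \sum_i c i *: 'X^(q ^ i)] for
small [s], and [P] is non-zero as soon as some [c i] is, the exponents [q ^ i]
being distinct.  Since [f(s)] is closer to [0] than any non-zero root of [P]
when [s] is small, it is then [0]. *)
Lemma tau_iter_free u n (c : 'I_n -> C) : u <> 0 ->
  \sum_i c i *: iter i tau u = 0 -> forall i, c i = 0.
Proof.
move=> u0; have [f uf] := F1_repr u.
have sumE : F1_germ (\sum_i c i *: iter i tau u) =
    germ_of (fun s => \sum_i c i * f s ^+ (q ^ i)).
  elim: n c => [|n IH] c.
    by rewrite big_ord0; congr germ_of; apply/funext => s; rewrite big_ord0.
  rewrite big_ord_recr.
  apply: etrans (addF1_germ (IH (fun i => c (widen_ord (leqnSn n) i)))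
    (scaleF1_germ (c ord_max) (tau_iter_germ n uf))) _.
  by congr germ_of; apply/funext => s; rewrite big_ord_recr.
move=> E; move: sumE; rewrite E => /germ_ofP Pf i.
apply/eqP/negP => /negP ci; apply: u0.
pose P : {poly C} := \sum_i c i *: 'X^(q ^ i).
have P0 : P != 0.
  apply: contra_neq ci => /(congr1 (fun p : {poly C} => p`_(q ^ i))).
  rewrite coef0 coef_sum (bigD1 i) //= coefZ coefXn eqxx mulr1 big1 ?addr0 // => j ji.
  rewrite coefZ coefXn eqn_exp2l ?q_gt1 // -[(i : nat) == j]/(i == j) eq_sym (negPf ji).
  by rewrite mulr0.
have fL : linear_series f by apply/linear_germP; rewrite -uf; case: (u).
have [r r0 hr] := poly_no_small_root P0.
apply: val_inj; rewrite /= uf; apply/germ_ofP.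
apply: near0W (near0I Pf (linear_series_cvg0 fL r0)) => s [Ps fr].
apply: hr fr _; rewrite /P horner_sum -[RHS]/((0 : C -> C^o) s) Ps.
by apply: eq_bigr => j _; rewrite hornerZ hornerXn.
Qed.

(** * Normal forms and redundancy in the Carlitz ring *)
Definition carlitz_monomial (l m : nat) : F1 C -> F1 C := iter l tau \o iter m ds.

Definition monomial_at u l m : F1 C := carlitz_monomial l m u.

(** The maps [F1 C -> F1 C] form a [C]-module under pointwise operations, in
which left composition with [tau] is semilinear. *)
Lemma comp_tau_preceding d k (psi : F1 C -> F1 C) :
  lin_span (preceding carlitz_monomial d k) psi ->
  lin_span (preceding carlitz_monomial d.+1 k.+1) (tau \o psi).
Proof.
move: psi; apply: (@lin_span_semilinear _ _ _ (fun psi => tau \o psi) (fun c => c ^+ q)).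
- by apply/funext => u; exact: tau0.
- by move=> psi psi'; apply/funext => u; exact: tauD.
- by move=> c psi; apply/funext => u; exact: tauZ.
by move=> _ [l [m [h ->]]]; apply: sub_lin_span; exists l.+1, m; split; [lia|].
Qed.

Lemma comp_ds_preceding d k (psi : F1 C -> F1 C) :
  lin_span (preceding carlitz_monomial d k) psi ->
  lin_span (preceding carlitz_monomial d.+1 k) (ds \o psi).
Proof.
move: psi; apply: (@lin_span_semilinear _ _ _ (fun psi => ds \o psi) (@qroot R F C)).
- by apply/funext => u; exact: ds0.
- by move=> psi psi'; apply/funext => u; exact: dsD.
- by move=> c psi; apply/funext => u; exact: dsZ.
move=> _ [[|l] [m [h ->]]].
  by apply: sub_lin_span; exists 0%N, m.+1; split; [lia|].
have [b hb] := ds_iter_tau l.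
have -> : ds \o carlitz_monomial l.+1 m =
    carlitz_monomial l.+1 m.+1 + b *: carlitz_monomial l m.
  by apply/funext => u; exact: hb.
by apply: lin_spanD; last apply: lin_spanZ; apply: precedingP; lia.
Qed.

Lemma eval_preceding u d k (psi : F1 C -> F1 C) :
  lin_span (preceding carlitz_monomial d k) psi ->
  lin_span (preceding (monomial_at u) d k) (psi u).
Proof.
move: psi; apply: (@lin_span_semilinear _ _ _ (fun psi => psi u) id) => //.
by move=> _ [l [m [h ->]]]; exact: (precedingP (monomial_at u) h).
Qed.

Lemma tau_preceding u d k v : lin_span (preceding (monomial_at u) d k) v ->
  lin_span (preceding (monomial_at u) d.+1 k.+1) (tau v).
Proof.
move: v; apply: (lin_span_semilinear tau0 tauD tauZ) => _ [l [m [h ->]]].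
apply: (@eval_preceding u _ _ (tau \o carlitz_monomial l m)).
exact: comp_tau_preceding (precedingP _ h).
Qed.

Lemma ds_preceding u d k v : lin_span (preceding (monomial_at u) d k) v ->
  lin_span (preceding (monomial_at u) d.+1 k) (ds v).
Proof.
move: v; apply: (lin_span_semilinear ds0 dsD dsZ) => _ [l [m [h ->]]].
apply: (@eval_preceding u _ _ (ds \o carlitz_monomial l m)).
exact: comp_ds_preceding (precedingP _ h).
Qed.

Lemma redundant_tau u d l :
  redundant (monomial_at u) d l -> redundant (monomial_at u) d.+1 l.+1.
Proof. by move=> /asboolP h; apply/asboolP; rewrite subSS; exact: tau_preceding h. Qed.

(** Applying [ds] to the monomial itself yields the monomial of degree [d.+1]
plus a multiple of one of degree [d - 1], which has to be subtracted. *)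
Lemma redundant_ds u d l : (l <= d)%N ->
  redundant (monomial_at u) d l -> redundant (monomial_at u) d.+1 l.
Proof.
move=> ld /asboolP h; apply/asboolP; rewrite subSn //.
(* For [l = 0] no correction term occurs and [hd] is the claim. *)
have hd := ds_preceding h; case: l ld h hd => [//|l] ld _.
have [b hb] := ds_iter_tau l.
rewrite /monomial_at /carlitz_monomial /= in hb *.
rewrite hb => hd; rewrite -[X in lin_span _ X](addrK (b *: monomial_at u l (d - l.+1))).
apply: lin_spanD => //; apply: lin_spanN; apply: lin_spanZ.
by apply: precedingP; lia.
Qed.

Lemma preceding_degree_mono d d' : (d <= d')%N ->
  lin_span (preceding carlitz_monomial d 0) `<=` lin_span (preceding carlitz_monomial d' 0).
Proof.
by move=> dd; apply: lin_span_sub => _ [l [m [h ->]]]; apply: precedingP; lia.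
Qed.

Lemma carlitz_ring_normal_form phi : carlitz_ring phi ->
  exists d, lin_span (preceding carlitz_monomial d 0) phi.
Proof.
(* Left multiplication by each generator is controlled, so it is the map
   [psi -> phi \o psi] that is followed along the construction of [phi]. *)
move=> hphi; suff H psi : (exists d, lin_span (preceding carlitz_monomial d 0) psi) ->
    exists d, lin_span (preceding carlitz_monomial d 0) (phi \o psi).
  apply: (H idfun); exists 1%N.
  by apply: (precedingP carlitz_monomial (l' := 0) (m' := 0)).
elim: hphi psi => {phi} [||c|phi1 phi2 _ IH1 _ IH2|phi1 phi2 _ IH1 _ IH2] psi.
- move=> [d /comp_tau_preceding h]; exists d.+2; apply: lin_span_sub h => _ [l [m [h ->]]].
  by apply: precedingP; lia.
- by move=> [d /comp_ds_preceding h]; exists d.+1.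
- by move=> [d h]; exists d; exact: lin_spanZ.
- move=> hpsi; have [d1 h1] := IH1 _ hpsi; have [d2 h2] := IH2 _ hpsi.
  exists (maxn d1 d2); apply: lin_spanD.
    exact: preceding_degree_mono (leq_maxl _ _) _ h1.
  apply: (@lin_spanN _ _ _ (phi2 \o psi)).
  exact: preceding_degree_mono (leq_maxr _ _) _ h2.
- by move=> /IH2/IH1.
Qed.

(** Without redundant monomials, evaluation at [u] is injective on the span of
the monomials: by induction along the order of monomials, a non-zero
coefficient at the last one would make it redundant. *)
Lemma annihilator_redundant phi u d :
  lin_span (preceding carlitz_monomial d 0) phi -> phi <> (fun=> 0) -> phi u = 0 ->
  exists d' l, (l <= d')%N /\ redundant (monomial_at u) d' l.
Proof.
move=> hphi phi0 phiu; apply: contrapT => none; apply: phi0.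
elim: d phi hphi phiu => [|d IH] phi.
  by rewrite preceding0 => /lin_span_set0.
rewrite -preceding_degreeS.
have : (d.+1 <= d.+1)%N by [].
elim: {1 3}d.+1 phi => [|l IHl] phi ld; first exact: IH.
rewrite precedingS // => /lin_span_setU1[c [psi [hpsi ->]]].
rewrite -[(_ + psi) u]/(c *: monomial_at u l (d - l)%N + psi u) => hu.
have := eval_preceding u hpsi => hpsiu.
have c0 : c = 0.
  apply/eqP/negP => /negP c0; apply: none; exists d, l; split => //; apply/asboolP.
  rewrite -[monomial_at u _ _]scale1r -(mulVf c0) -scalerA; apply: lin_spanZ.
  by move/eqP: hu; rewrite addr_eq0 => /eqP ->; exact: lin_spanN.
move: hu; rewrite c0 !scale0r !add0r; exact: IHl (ltnW ld) hpsi.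
Qed.

Lemma carlitz_filtrationE u j :
  carlitz_filtration u j = lin_span (preceding (monomial_at u) j.+1 0).
Proof.
by apply/seteqP; split; apply: lin_span_sub => _ [l [m [h ->]]]; apply: sub_lin_span;
  exists l, m; split => //; lia.
Qed.

End CarlitzOperators.

(** * The dimension *)
Theorem theorem2 (R : realType) (F : finFieldType) (C : completed_closure R F)
    (f : F1 C) (hf : f <> 0)
    (phi : F1 C -> F1 C) (hphi : carlitz_ring phi)
    (hphi0 : phi <> (fun=> 0)) (hphif : phi f = 0) :
  quasi_holonomic f.
Proof.
have [d0 hd0] := carlitz_ring_normal_form hphi.
have [d [l [ld rl]]] := annihilator_redundant hd0 hphi0 hphif.
pose h := standard_count (monomial_at f).
have hmono j : (d <= j)%N -> (h j.+1 <= h j)%N.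
  move=> dj; apply: (standard_count_leq (@redundant_tau _ _ _ f) (@redundant_ds _ _ _ f)).
    exact: leq_trans ld dj.
  exact: (redundant_later (@redundant_ds _ _ _ f) ld rl dj).
have [c [J hc]] := nonincreasing_stationary hmono.
have dimE := staircase_dim (monomial_at f).
have sumE := sum_stationary hc.
have c0 : c != 0%N.
  (* With [c = 0] all filtration steps would have dimension at most [N]; the
     step of degree [J + N] contains [N.+1] independent vectors. *)
  apply/eqP => c0; set N := (\sum_(i < J) h i)%N in sumE.
  have bound := sumE (J + N).+1 (leqW (leq_addr _ _)).
  rewrite c0 !mul0n !addn0 in bound.
  suff : (N.+1 <= N)%N by rewrite ltnn.
  rewrite -{2}bound.
  apply: (free_leq_dim (b := fun i : 'I_N.+1 => iter i (@tau R F C) f) (dimE _)).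
    move=> i; apply: (precedingP (monomial_at f) (l' := i) (m' := 0)).
    by have := ltn_ord i; lia.
  by move=> k; exact: tau_iter_free.
(* The step of degree [j] has dimension [\sum_(i < j.+1) h i], which equals
   [\sum_(i < J) h i + c * (j.+1 - J)]. *)
pose B : rat := (\sum_(i < J) h i)%:R + c%:R - c%:R * J%:R.
exists (c%:R *: 'X + B%:P); split.
  rewrite size_polyDl size_scale ?size_polyX ?pnatr_eq0 //.
  exact: leq_ltn_trans (size_polyC_leq1 _) _.
exists J => j Jj; exists (\sum_(i < j.+1) h i)%N; split.
  by rewrite carlitz_filtrationE.
have /(congr1 (fun n : nat => n%:R : rat)) := sumE _ (leqW Jj).
rewrite !natrD !natrM hornerD hornerZ hornerX hornerC /B -(natr1 j) => E.
apply: (addIr (c%:R * J%:R)); rewrite E; ring.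
Qed.
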